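(* Under the MNL model, the optimal objective of the static approximation need not converge to the optimal objective of the stochastic problem as $T\to\infty$; that is, there exists an instance of the problem for which $V_T^*(\bar S)-V_T^{\mathrm{Static}}(\bar S)$ does not tend to $0$ as $T\to\infty$.
   Context: An instance consists of: a finite set of unique items $\mathcal{L}$; a finite set $\bar S$ of $N$ options partitioning $\mathcal{L}$ (an option is a single item or a sequence of several distinct items), where option $i$ has salvage value $\xi_i\in\mathbb{R}$ (the sum of its items' salvage values); a finite set $\Omega$ of customer types and a random type $X$ with probability mass function $p_X$ on $\Omega$ ($\mathbb{E}_X$ is expectation over $X$); an arrival probability $\mu\in(0,1]$ per period (types i.i.d. across periods, $T$ periods in total); qualities $q_i^\omega\in\mathbb{R}$; and a price sensitivity $\beta_p<0$. MNL model: $\rho_i^\omega(p,S)=\dfrac{e^{q_i^\omega+\beta_pp_i}}{1+\sum_{j\in S}e^{q_j^\omega+\beta_pp_j}}$ for $i\in S$, $p\in\mathbb{R}^{|S|}$. Value function (stochastic problem): for $S\subseteq\bar S$, $V_0^*(S)=\sum_{i\in S}\xi_i$ and, for $t\ge1$, $V_t^*(S)=V_{t-1}^*(S)+\mu\,\mathbb{E}_X\big[R(\rho^X,S,\Delta V_t^*(S))\big]$, where $\Delta_iV_t^*(S)=V^*_{t-1}(S)-V^*_{t-1}(S\setminus\{i\})$ and $R(g,S,\Delta)=\max_{p\in\mathbb{R}^{|S|}}\sum_{i\in S}g_i(p,S)(p_i-\Delta_i)$. Static approximation: $V_T^{\mathrm{Static}}(\bar S)$ is the optimal objective value of $$\max_{\rho\in(0,1)^{N\times|\Omega|}}\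 \sum_{i\in\bar S}\frac{1-(1-\mu\mathbb{E}_X[\rho_i^X])^T}{\mathbb{E}_X[\rho_i^X]}\,\mathbb{E}_X\big[\rho_i^Xp_i^X(\rho^X)\big]+\sum_{i\in\bar S}(1-\mu\mathbb{E}_X[\rho_i^X])^T\xi_i\quad\text{s.t.}\quad\sum_{i\in\bar S}\rho_i^\omega\le1\ \ \forall\omega\in\Omega,$$ where $p_i^\omega(\rho^\omega)=\frac1{\beta_p}\big(\ln\rho_i^\omega-\ln\rho_0^\omega-q_i^\omega\big)$ with $\rho_0^\omega=1-\sum_{j\in\bar S}\rho_j^\omega$. *)

(* Defs.v *)
From HB Require Import structures.
From mathcomp Require Import all_boot all_order all_algebra.
From mathcomp Require Import all_classical all_reals all_analysis.
Import Order.TTheory GRing.Theory Num.Theory.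
Import numFieldNormedType.Exports.

Set Implicit Arguments.
Unset Strict Implicit.
Unset Printing Implicit Defensive.

Local Open Scope classical_set_scope.
Local Open Scope ring_scope.

(* The horizon T is not a field: the instance is fixed while T varies. *)
Record instance (R : realType) : Type := Instance {
  item : finType;
  (* labels of the options; [option_items i] is the sequence sold as option i *)
  opt : finType;
  option_items : opt -> seq item;
  option_nonempty : forall i, option_items i != [::];
  (* every item occurs exactly once, in exactly one option *)
  option_partition :
    perm_eq (flatten [seq option_items i | i <- enum opt]) (enum item);
  item_salvage : item -> R;
  ctype : finType;
  pX : ctype -> R;
  pX_ge0 : forall w, 0 <= pX w;
  pX_sum1 : \sum_(w : ctype) pX w = 1;
  mu : R;
  mu_gt0 : 0 < mu;
  mu_le1 : mu <= 1;
  quality : ctype -> opt -> R;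
  beta : R;
  beta_lt0 : beta < 0
}.

Section Model.
Context {R : realType} (I : instance R).

Definition salvage (i : opt I) : R :=
  \sum_(l <- option_items i) item_salvage l.

Definition EX (f : ctype I -> R) : R := \sum_(w : ctype I) pX w * f w.

Definition EXe (f : ctype I -> \bar R) : \bar R :=
  (\sum_(w : ctype I) (pX w)%:E * f w)%E.

(* Price vectors in R^|S| are represented by functions on all options; the
   entries outside S are never read. *)
Definition mnl (w : ctype I) (p : opt I -> R) (S : {set opt I}) (i : opt I) : R :=
  expR (quality w i + beta I * p i) /
  (1 + \sum_(j in S) expR (quality w j + beta I * p j)).

(* The maximum over prices is written as a supremum.  For g = mnl w the set of
   values is nonempty and, since beta < 0, bounded above, so that [sup] does not
   take its default value. *)
Definition max_revenue (g : (opt I -> R) -> {set opt I} -> opt I -> R)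
    (S : {set opt I}) (Delta : opt I -> R) : R :=
  sup [set \sum_(i in S) g p S i * (p i - Delta i) | p in [set: opt I -> R]].

Fixpoint Vstar (t : nat) (S : {set opt I}) : R :=
  if t is t'.+1 then
    Vstar t' S + mu I * EX (fun w =>
      max_revenue (mnl w) S (fun i => Vstar t' S - Vstar t' (S :\ i)%SET))
  else \sum_(i in S) salvage i.

Definition rho0 (rho : ctype I -> opt I -> R) (w : ctype I) : R :=
  1 - \sum_(j : opt I) rho w j.

(* Extended-real valued: the constraint allows rho0 = 0, where ln 0 = -oo and
   hence the price is -oo. *)
Definition static_price (rho : ctype I -> opt I -> R) (w : ctype I)
    (i : opt I) : \bar R :=
  ((beta I)^-1%:E *
    (lne (rho w i)%:E - lne (rho0 rho w)%:E - (quality w i)%:E))%E.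

Definition static_feasible (rho : ctype I -> opt I -> R) : Prop :=
  (forall w i, 0 < rho w i < 1) /\ (forall w, \sum_(i : opt I) rho w i <= 1).

Definition static_objective (T : nat) (rho : ctype I -> opt I -> R) : \bar R :=
  let m i := EX (fun w => rho w i) in
  (\sum_(i : opt I)
     ((1 - (1 - mu I * m i) ^+ T) / m i)%:E *
       EXe (fun w => (rho w i)%:E * static_price rho w i)
   + \sum_(i : opt I) ((1 - mu I * m i) ^+ T * salvage i)%:E)%E.

Definition Vstatic (T : nat) : \bar R :=
  ereal_sup [set static_objective T rho | rho in static_feasible].

End Model.

(* Main.v *)
(* The gap already opens for a single item with zero salvage value, one customer
   type, mu = 1, quality 0 and beta = -1.  Dynamic pricing earns at least
   ln T - O(1): offering the price V_t + 1 makes exp(V_t) grow by at least a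
   constant in each period.  A static policy with purchase probability r earns
   at most (1 - (1 - r)^T) ln (1/r).  If r T is large this is far below ln T; if
   r T stays bounded, the probability of not selling is bounded away from 0,
   which costs a fixed fraction of ln T.  Hence the static value is eventually
   below ln T - K for every constant K. *)
Require Import Defs.
From mathcomp Require Import all_boot all_order all_algebra.
From mathcomp Require Import all_classical all_reals all_analysis.
From mathcomp Require Import ring lra.
Import Order.TTheory GRing.Theory Num.Theory.
Import numFieldNormedType.Exports.

Local Open Scope classical_set_scope.
Local Open Scope ring_scope.

(** For [r <= 1/2], [1 / (1 - r) <= 1 + 2 * r <= expR (2 * r)]; invert and take powers. *)
Lemma pow1B_ge_expR (R : realType) (r : R) (n : nat) :
  0 <= r <= 2^-1 -> expR (- (2 * (r * n%:R))) <= (1 - r) ^+ n.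
Proof.
move=> /andP[r0 r1].
have h : expR (- (2 * r)) <= 1 - r.
  have d0 : 0 < 1 - r by lra.
  rewrite expRN -[leRHS]invrK lef_pV2 ?posrE ?invr_gt0 ?expR_gt0//.
  apply: le_trans (expR_ge1Dx _).
  rewrite -div1r ler_pdivrMr //; nra.
rewrite [X in expR X](_ : _ = n%:R * (- (2 * r))); last by ring.
by rewrite expRM_natl lerXn2r ?nnegrE ?expR_ge0 //; lra.
Qed.

Lemma one_sub_pow1B_le (R : realType) (r : R) (n : nat) :
  0 <= r <= 1 -> 1 - (1 - r) ^+ n <= r * n%:R.
Proof.
move=> /andP[r0 r1]; elim: n => [|n IH]; first by rewrite expr0 mulr0 subrr.
rewrite exprS -natr1.
have : (1 - r) ^+ n <= 1 by apply: exprn_ile1; lra.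
nra.
Qed.

(** The threshold on [n] must not depend on [r], so that the bound survives the supremum over static
    policies. *)
Lemma static_revenue_le (R : realType) (K : R) :
  \forall n \near \oo, forall r : R, 0 < r < 1 ->
    (1 - (1 - r) ^+ n) * (ln (1 - r) - ln r) <= ln n%:R - K.
Proof.
(* The cases split at [r * n = M]: above it [- ln r <= ln n - K]; below it the no-sale probability
   is at least [d]. *)
pose M := expR K; pose d := expR (- (2 * M)).
have M0 : 0 < M by exact: expR_gt0.
have d0 : 0 < d by exact: expR_gt0.
near=> n => r /andP[r0 r1].
have nM : 2 * M <= n%:R by near: n; exact: nbhs_infty_ger.
have n0 : 0 < n%:R :> R by lra.
(* The loss [d * ln n] has to cover [K] and the error 1 from [bx]. *)
have dL : K + 1 <= d * ln n%:R.
  rewrite mulrC -ler_pdivrMr // -[leLHS]expRK ler_ln ?posrE ?expR_gt0 //.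
  by near: n; exact: nbhs_infty_ger.
have q0 : 0 <= (1 - r) ^+ n by apply: exprn_ge0; lra.
have q1 : (1 - r) ^+ n <= 1 by apply: exprn_ile1; lra.
have l1 : ln (1 - r) <= 0 by apply: ln_le0; lra.
have l2 : ln r <= 0 by apply: ln_le0; lra.
have x0 : 0 < r * n%:R by exact: mulr_gt0.
have lx : ln (r * n%:R) = ln r + ln n%:R by rewrite lnM ?posrE.
have [Mx|xM] := leP M (r * n%:R).
  have : K <= ln (r * n%:R) by rewrite -[leLHS]expRK ler_ln ?posrE.
  nra.
have rh : r <= 2^-1 by nra.
have dq : d <= (1 - r) ^+ n.
  apply: le_trans (@pow1B_ge_expR _ r n _); last by lra.
  rewrite ler_expR; lra.
(* With [x = r * n], the sale probability is at most [x], and [x * ln (1/x) <= 1]. *)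
have bx : (1 - (1 - r) ^+ n) * - ln (r * n%:R) <= 1.
  have [ln0|ln0] := leP 0 (ln (r * n%:R)); first by nra.
  have ax : 1 - (1 - r) ^+ n <= r * n%:R by apply: one_sub_pow1B_le; lra.
  have := @ln_sublinear _ (r * n%:R)^-1; rewrite invr_gt0 => /(_ x0).
  rewrite lnV ?posrE // => h.
  apply: (@le_trans _ _ (r * n%:R * - ln (r * n%:R))).
    by apply: ler_wpM2r => //; lra.
  by rewrite mulrC -ler_pdivlMr // div1r ltW.
have L0 : 0 <= ln n%:R :> R by apply: ln_ge0; rewrite ler1n -(ltr0n R).
rewrite lx in bx.
have e : (1 - (1 - r) ^+ n) * (ln (1 - r) - ln r) =
  (1 - (1 - r) ^+ n) * ln (1 - r) + (1 - (1 - r) ^+ n) * ln n%:R +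
  (1 - (1 - r) ^+ n) * - (ln r + ln n%:R) by ring.
rewrite {}e.
have : (1 - (1 - r) ^+ n) * ln (1 - r) <= 0 by nra.
have : (1 - (1 - r) ^+ n) * ln n%:R <= (1 - d) * ln n%:R.
  by apply: ler_wpM2r => //; lra.
lra.
Unshelve. all: by end_near.
Qed.

Lemma big_unit {T : Type} {idx : T} (op : Monoid.law idx) (F : unit -> T) :
  \big[op/idx]_(i : unit) F i = F tt.
Proof. by rewrite (big_pred1 tt) // => -[]. Qed.

Lemma big_setT_unit (T : Type) (idx : T) (op : Monoid.law idx) (F : unit -> T) :
  \big[op/idx]_(i in [set: unit]%SET) F i = F tt.
Proof. by rewrite -[RHS](big_unit op); apply: eq_bigl => i; rewrite finset.in_setT. Qed.

Lemma single_partition :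
  perm_eq (flatten [seq [:: i] | i : unit]) (enum {: unit}).
Proof. by rewrite flatten_map1 map_id. Qed.

Lemma sum_unit1 (R : realType) : \sum_(w : unit) (1 : R) = 1.
Proof. exact: big_unit. Qed.

Definition single_item_instance (R : realType) : instance R :=
  @Instance R unit unit (fun i => [:: i]) (fun=> isT) single_partition (fun=> 0)
    unit (fun=> 1) (fun=> ler01) (sum_unit1 R) 1 ltr01 (lexx 1) (fun _ _ => 0)
    (-1) (ltrN10 R).

Section SingleItem.
Context {R : realType}.
Notation I := (single_item_instance R).

Let V (t : nat) : R := Vstar t [set: opt I]%SET.

Lemma Vstar_set0 t : Vstar t (finset.set0 : {set opt I}) = 0.
Proof.
elim: t => [|t IH] /=; first by rewrite big_set0.
rewrite IH add0r mul1r /EX big_unit mul1r /max_revenue -[RHS](sup1 (0 : R)).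
congr sup; apply/seteqP; split => [x [p _ <-]|x ->] /=; first by rewrite big_set0.
by exists (fun=> 0) => //; rewrite big_set0.
Qed.

Lemma VstarS_ge t : V t + expR (- (V t + 1)) / (1 + expR (- (V t + 1))) <= V t.+1.
Proof.
rewrite /V /= mul1r /EX big_unit mul1r lerD2l /max_revenue.
set D := Vstar t _.
have E (p : opt I -> R) :
    \sum_(i in [set: opt I]%SET) mnl (I := I) tt p [set: opt I]%SET i *
      (p i - (D - Vstar t ([set: opt I] :\ i)%SET)) =
    expR (- p tt) / (1 + expR (- p tt)) * (p tt - D).
  rewrite big_setT_unit (_ : [set: opt I] :\ tt = finset.set0)%SET; last first.
    by apply/setP => -[]; rewrite !inE.
  by rewrite Vstar_set0 subr0 /mnl big_setT_unit /= add0r mulN1r.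
apply: ub_le_sup; last first.
  exists (fun=> D + 1) => //; rewrite E; ring.
(* Without an upper bound [sup] would take its default value. This one comes from
   [s * expR (- s) <= 1] at [s = p tt - D]. *)
exists (expR (- D)) => x [p _ <-]; rewrite E.
set y := expR (- p tt); have y0 : 0 < y by exact: expR_gt0.
have b0 := expR_gt0 (- D).
have [h|h] := leP (p tt) D.
  apply: (@le_trans _ _ 0); last exact: ltW.
  by apply: mulr_ge0_le0; [rewrite divr_ge0 //; lra | lra].
apply: (@le_trans _ _ (y * (p tt - D))).
  apply: ler_wpM2r; first lra.
  rewrite ler_pdivrMr; [nra|lra].
rewrite /y (_ : - p tt = - D - (p tt - D)); last by ring.
rewrite expRB -mulrA; apply: ler_piMr; first exact: ltW.
rewrite mulrC ler_pdivrMr ?expR_gt0 // mul1r.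
have := expR_ge1Dx (p tt - D); lra.
Qed.

Lemma Vstar_ge_ln t : ln t.+1%:R - ln (1 + expR 1) <= V t.
Proof.
have c0 : 0 < 1 + expR 1 :> R by have := expR_gt0 (1 : R); lra.
suff h : t.+1%:R / (1 + expR 1) <= expR (V t).
  by rewrite -ln_div ?posrE // -[leRHS]expRK ler_ln ?posrE ?expR_gt0 ?divr_gt0 //.
(* Nonnegativity is carried along because the growth of [expR (V t)] in one step is at least
   [1 / (e + expR (- V t))], which is at least [1 / (1 + e)] once [V t >= 0]. *)
suff [_] : 0 <= V t /\ 1 + t%:R / (1 + expR 1) <= expR (V t).
  apply: le_trans; rewrite -natr1 mulrDl addrC lerD2r ler_pdivrMr // mul1r.
  by have := expR_gt0 (1 : R); lra.
elim: t => [|t [IH0 IH]].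
  rewrite /V /= big1 ?expR0 ?mul0r ?addr0 // => i _.
  by rewrite /salvage /= big_seq1.
have H := VstarS_ge t.
set u := expR (- (V t + 1)) in H.
have u0 : 0 < u by exact: expR_gt0.
have uu : 0 < u / (1 + u) by rewrite divr_gt0 //; lra.
split; first lra.
have e1 : 1 + u / (1 + u) <= expR (V t.+1 - V t).
  apply: le_trans (expR_ge1Dx _); lra.
have e2 : expR (V t.+1) = expR (V t) * expR (V t.+1 - V t).
  by rewrite -expRD; congr expR; ring.
have e3 : expR (V t) * expR 1 * u = 1.
  by rewrite -!expRD -[RHS]expR0; congr expR; ring.
have Vge1 : 1 <= expR (V t) by rewrite -expR0 ler_expR.
have e4 : (1 + expR 1)^-1 <= expR (V t) * (u / (1 + u)).
  rewrite mulrA ler_pdivlMr; last lra.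
  rewrite mulrC ler_pdivrMr //; nra.
rewrite e2 -natr1 mulrDl mul1r; nra.
Qed.

(** With a single option, [rho < 1] forces [rho0 > 0], so both logarithms are finite and the
    purchase probability cancels. *)
Lemma static_objective_single T rho : static_feasible (I := I) rho ->
  static_objective T rho =
  ((1 - (1 - rho tt tt) ^+ T) * (ln (1 - rho tt tt) - ln (rho tt tt)))%:E.
Proof.
move=> [/(_ tt tt) /andP[r0 r1] _].
rewrite /static_objective !big_unit /EXe /EX !big_unit /static_price /rho0.
rewrite !big_unit !lne_EFin ?subr_gt0 // /salvage /= big_seq1 !mulr0 !mul1r.
rewrite adde0 mul1e.
rewrite -!EFinB -!EFinM subr0; congr (_%:E).
rewrite invrN1; field; lra.
Qed.

End SingleItem.

Theorem mainTheorem8 (R : realType) :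
  exists I : instance R,
    ~ ((fun T : nat => ((Vstar T [set: opt I]%SET)%:E - Vstatic I T)%E)
         @ \oo --> 0%E).
Proof.
exists (single_item_instance R) => h.
suff : (1%:E <= 0%:E :> \bar R)%E by rewrite lee_fin ler10.
apply: (cvge_to_ge h); near=> T.
have T0 : (0 < T)%N by near: T; exact: nbhs_infty_ge.
(* [K = ln (1 + e) + 1] exceeds the constant lost in [Vstar_ge_ln] by 1, so the gap is eventually at
   least 1. *)
apply: (@le_trans _ _ ((Vstar T [set: opt (single_item_instance R)]%SET)%:E
    - (ln T%:R - (ln (1 + expR 1) + 1))%:E)%E).
  rewrite -EFinB lee_fin.
  have := @Vstar_ge_ln R T.
  have : ln T%:R <= ln T.+1%:R :> R by rewrite ler_ln ?posrE ?ltr0n ?ler_nat.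
  lra.
rewrite leeB // /Vstatic; apply: ge_ereal_sup => _ [rho Hrho <-].
rewrite static_objective_single // lee_fin.
have [/(_ tt tt) hr _] := Hrho.
move: (rho tt tt) hr; near: T.
exact: static_revenue_le.
Unshelve. all: by end_near.
Qed.
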